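(* Let $\Sigma=\{0,1\}$, let $f$ be a (partial) function from $\Sigma^\omega$ to $\mathbb{R}$, and let $\hat f$ be the corresponding (partial) real function on $[0,1)$. Then $\hat f$ is uniformly continuous on $[0,1)$ (in particular everywhere defined there) if and only if: (1) $f$ is uniformly continuous in $\Omega$ (in particular defined at every point of $\Omega$), and (2) for all finite words $v\in\Sigma^*$ the equality $g(v10^\omega)=g(v01^\omega)$ holds, where $g:\Sigma^\omega\to\mathbb{R}$ is the (unique) continuous function such that $f|_\Omega=g|_\Omega$.
   Context: $\Sigma=\{0,1\}$; $\Sigma^*$ is the set of finite words, $\Sigma^\omega$ the set of infinite words with metric $d_C(w,w')=2^{-k}$, $k$ the length of the longest common prefix of $w\neq w'$. For $w\in\Sigma^\omega$ put $num(w)=\sum_{i\ge1}w_i2^{-i}$, and let $\Omega=\Sigma^\omega\setminus\Sigma^*1^\omega$, a dense subset of $\Sigma^\omega$. Then $num|_\Omega:\Omega\to[0,1)$ is a bijection with inverse $bin$. The real function corresponding to $f$ is $\hat f(x)=f(bin(x))$ for $x\in[0,1)$ (undefined where $f(bin(x))$ is undefined). Uniform continuity of $f$ in $\Omega$ refers to the restriction $f|_\Omega$; it guarantees that the function $g$ in (2) exists and is unique. *)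

(* Defs.v *)
From HB Require Import structures.
From mathcomp Require Import all_boot all_order all_algebra.
From mathcomp Require Import all_classical all_reals all_analysis.
Set Implicit Arguments.
Unset Strict Implicit.
Unset Printing Implicit Defensive.
Import Order.TTheory GRing.Theory Num.Theory.
Import numFieldNormedType.Exports.
Local Open Scope classical_set_scope.
Local Open Scope ring_scope.

(* Letter w_i (i >= 1) of an infinite word w is [w i.-1].  The parameter R is
   only the field in which the metric below takes its values; it has to occur
   in the type for the metric to be a canonical instance. *)
Definition iword (R : realType) : Type := nat -> bool.

HB.instance Definition _ (R : realType) := gen_eqMixin (iword R).
HB.instance Definition _ (R : realType) := gen_choiceMixin (iword R).

(* [mkseq w k] is the prefix of w of length k.  The default 0 is used only
   when w = w', where there is no longest common prefix. *)
Definition lcp (R : realType) (w w' : iword R) : nat :=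
  xget 0%N [set k | mkseq w k = mkseq w' k /\
                    forall j, mkseq w j = mkseq w' j -> (j <= k)%N].

Definition dC (R : realType) (w w' : iword R) : R :=
  if w == w' then 0 else 2 ^- lcp w w'.

Section metric.
Variable R : realType.
Implicit Types w x y z : iword R.

Lemma eq_prefixP w w' n :
  mkseq w n = mkseq w' n <-> forall i, (i < n)%N -> w i = w' i.
Proof.
split=> [e i ltin | e].
  by rewrite -(nth_mkseq false w ltin) e nth_mkseq.
by apply/eq_in_map => i; rewrite mem_iota => /andP[_]; exact: e.
Qed.

Lemma lcpP w w' : w <> w' ->
  mkseq w (lcp w w') = mkseq w' (lcp w w') /\
  forall j, mkseq w j = mkseq w' j -> (j <= lcp w w')%N.
Proof.
move=> neq; rewrite /lcp; case: xgetP => [k _ //|] none; exfalso.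
have ex : exists k, w k != w' k.
  apply: contrapT => nex; apply: neq; apply/funext => i.
  by apply/eqP/negPn/negP => h; apply: nex; exists i.
case: (ex_minnP ex) => k wk kmin.
apply: (none k); split=> [|j /eq_prefixP ej].
  apply/eq_prefixP => i ltik; apply/eqP/negPn/negP => /kmin.
  by rewrite leqNgt ltik.
by rewrite leqNgt; apply/negP => /ej /eqP; rewrite (negPf wk).
Qed.

Lemma dC_lt w w' n : dC w w' < 2 ^- n <-> mkseq w n.+1 = mkseq w' n.+1.
Proof.
rewrite /dC; case: eqP => [-> | neq].
  by split=> // _; rewrite invr_gt0 exprn_gt0.
have [eqp lmax] := lcpP neq.
rewrite ltf_pV2 ?posrE ?exprn_gt0// ltr_eXn2l ?ltr1n//.
split=> [lt|/lmax//].
by apply/eq_prefixP => i lti; move/eq_prefixP: eqp; apply; apply: leq_trans lti lt.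
Qed.

Lemma dC_ge0 w w' : 0 <= dC w w'.
Proof. by rewrite /dC; case: eqP => // _; rewrite invr_ge0 exprn_ge0. Qed.

Lemma dCxx w : dC w w = 0.
Proof. by rewrite /dC eqxx. Qed.

Lemma dC_eq0 w w' : dC w w' = 0 -> w = w'.
Proof.
rewrite /dC; case: eqP => // _ /eqP.
by rewrite invr_eq0 expf_eq0 pnatr_eq0 andbF.
Qed.

Lemma dC_sym w w' : dC w w' = dC w' w.
Proof.
rewrite /dC eq_sym; congr (if _ then _ else 2 ^- _).
by congr xget; apply/seteqP; split=> k /= [e h]; split=> [//|j /esym]; exact: h.
Qed.

Lemma dC_triangle y x z : dC x z <= dC x y + dC y z.
Proof.
have [->|/eqP neq] := eqVneq x z; first by rewrite dCxx addr_ge0 ?dC_ge0.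
have dE : dC x z = 2 ^- lcp x z by rewrite /dC; case: eqP.
have [xy|xy] := leP (dC x z) (dC x y).
  by rewrite (le_trans xy)// lerDl dC_ge0.
have [yz|yz] := leP (dC x z) (dC y z).
  by rewrite (le_trans yz)// lerDr dC_ge0.
move: xy yz; rewrite dE => /dC_lt xy /dC_lt yz.
by have := (lcpP neq).2 _ (etrans xy yz); rewrite ltnn.
Qed.

HB.instance Definition _ :=
  isMetric.Build R (iword R) dCxx dC_eq0 dC_sym dC_triangle.

End metric.

Definition wcat (R : realType) (v : seq bool) (w : iword R) : iword R :=
  fun i => nth (w (i - size v)%N) v i.

Definition zeros (R : realType) : iword R := fun=> false.
Definition ones (R : realType) : iword R := fun=> true.

Definition num_word (R : realType) (w : iword R) : R :=
  limn (series (fun i => (w i)%:R / 2 ^+ i.+1 : R)).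

Definition Omega (R : realType) : set (iword R) :=
  ~` [set w | exists v : seq bool, w = wcat v (ones R)].

(* The inverse of [num_word] restricted to [Omega]; the default word is
   irrelevant on [0, 1), the image of [Omega] under [num_word]. *)
Definition bin_word (R : realType) : R -> iword R :=
  'pinv_(fun=> zeros R) (@Omega R) (@num_word R).

(* Partial functions are [option]-valued, [None] meaning undefined. *)
Definition hat (R : realType) (f : iword R -> option R) (x : R) : option R :=
  if 0 <= x < 1 then f (bin_word x) else None.

Definition unif_continuous_on (R : realType) (X : pseudoMetricType R)
    (A : set X) (f : X -> option R) : Prop :=
  (forall x, A x -> f x <> None) /\
  (forall e : R, 0 < e -> exists2 d : R, 0 < d &
     forall x y : X, A x -> A y -> ball x d y ->
     forall a b : R, f x = Some a -> f y = Some b -> `|a - b| < e).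

Definition continuous_extension (R : realType) (f : iword R -> option R)
    (g : iword R -> R) : Prop :=
  continuous g /\ forall w, Omega w -> f w = Some (g w).

(* Main.v *)
(** Through the bijection [num_word : Omega -> [0, 1[], uniform continuity of
    [hat f] says that [f] is uniformly continuous on [Omega] for the
    pseudometric [`|num_word w - num_word w'|], which is dominated by [dC].
    The two uniform structures differ only across dyadic points: if w, w' in
    [Omega] first differ at i with w_i = 0, w'_i = 1 and their values are at
    distance < 2^-k, then w continues with ones and w' with zeros up to
    position k.  So w is [dC]-close to v01^omega and w' to v10^omega, with v
    the common prefix, and condition (2) bridges the gap. *)

Require Import Defs.
From mathcomp Require Import all_boot all_order all_algebra.
From mathcomp Require Import all_classical all_reals all_analysis.
From mathcomp Require Import ring lra.
Set Implicit Arguments.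
Unset Strict Implicit.
Unset Printing Implicit Defensive.
Import Order.TTheory GRing.Theory Num.Theory.
Import numFieldNormedType.Exports.
Local Open Scope classical_set_scope.
Local Open Scope ring_scope.

(** * Common prefixes and truncations *)

Definition agree {R : realType} (k : nat) (w w' : iword R) : Prop :=
  forall i, (i < k)%N -> w i = w' i.

Definition shift (R : realType) (w : iword R) : iword R := fun i => w i.+1.

(** These words of [Omega] converge to [w], which makes [Omega] dense. *)
Definition trunc (R : realType) (w : iword R) (n : nat) : iword R :=
  wcat (mkseq w n) (zeros R).

Definition set_letter (R : realType) (w : iword R) (j : nat) (b : bool) :
  iword R := fun i => if i == j then b else w i.

Lemma agreeC (R : realType) k (w w' : iword R) : agree k w w' -> agree k w' w.
Proof. by move=> h i /h. Qed.

Lemma agreeW (R : realType) k l (w w' : iword R) :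
  (k <= l)%N -> agree l w w' -> agree k w w'.
Proof. by move=> kl h i ik; apply: h; exact: leq_trans kl. Qed.

(** * Values of infinite words *)

Lemma num_word_is_cvg (R : realType) (w : iword R) :
  cvgn (series (fun i => (w i)%:R / 2 ^+ i.+1 : R)).
Proof.
apply: (@series_le_cvg _ _ (geometric 2^-1 2^-1)).
- by move=> n; rewrite divr_ge0// exprn_ge0.
- by move=> n; rewrite geometric_ge0// invr_ge0.
- move=> n /=; rewrite -exprS exprVn ler_piMl ?invr_ge0 ?exprn_ge0//.
  by case: (w n).
- by apply: is_cvg_geometric_series; rewrite ger0_norm ?invr_ge0// invf_lt1// ltr1n.
Qed.

Lemma num_wordS (R : realType) (w : iword R) :
  num_word w = ((w 0%N)%:R + num_word (shift w)) / 2.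
Proof.
rewrite mulrDl; apply: cvg_lim => //; rewrite -cvg_shiftS.
rewrite [X in X @ _ --> _](_ : _ = (fun n => (w 0%N)%:R / 2 +
    series (fun i => (shift w i)%:R / 2 ^+ i.+1) n / 2)); last first.
  apply/funext => n; rewrite !seriesEnat /= big_nat_recl// expr1; congr (_ + _).
  by rewrite mulr_suml; apply: eq_bigr => i _; rewrite -mulrA -invfM -exprSr.
apply: cvgD; first exact: cvg_cst.
by apply: cvgMl; exact: num_word_is_cvg.
Qed.

Lemma num_word_le (R : realType) (w w' : iword R) :
  (forall i, w i -> w' i) -> num_word w <= num_word w'.
Proof.
move=> le; apply: lim_series_le; try exact: num_word_is_cvg.
move=> n; rewrite ler_pM2r ?invr_gt0 ?exprn_gt0// ler_nat.
by case: (w n) (le n) => // ->.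
Qed.

(** A constant word is its own shift, so [num_wordS] becomes a linear equation for its value. *)
Lemma num_word_zeros (R : realType) : num_word (zeros R) = 0.
Proof. by have := num_wordS (zeros R); rewrite /shift /zeros/=; lra. Qed.

Lemma num_word_ones (R : realType) : num_word (ones R) = 1.
Proof. by have := num_wordS (ones R); rewrite /shift /ones/=; lra. Qed.

Lemma num_word_ge0 (R : realType) (w : iword R) : 0 <= num_word w.
Proof. by rewrite -(num_word_zeros R); apply: num_word_le. Qed.

Lemma num_word_le1 (R : realType) (w : iword R) : num_word w <= 1.
Proof. by rewrite -(num_word_ones R); apply: num_word_le. Qed.

(** Equal first letters cancel in [num_wordS], and each one halves the distance, which is at most 1
    at the start. *)
Lemma num_word_agree (R : realType) k (w w' : iword R) :
  agree k w w' -> `|num_word w - num_word w'| <= 2 ^- k.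
Proof.
elim: k w w' => [|k IH] w w' h.
  have := num_word_ge0 w; have := num_word_ge0 w'.
  have := num_word_le1 w; have := num_word_le1 w'.
  by rewrite expr0 invr1 ler_norml; lra.
rewrite (num_wordS w) (num_wordS w') (h 0%N)// exprSr invfM ler_pdivlMr//.
have /IH : agree k (shift w) (shift w') by move=> i ik; exact: h.
rewrite -[X in _ * X]ger0_norm// -normrM => /(le_trans _); apply.
by rewrite le_eqVlt; apply/orP; left; apply/eqP; congr `|_|; field.
Qed.

Lemma num_word_set_letter (R : realType) (w : iword R) j : w j = false ->
  num_word (set_letter w j true) = num_word w + 2 ^- j.+1.
Proof.
elim: j w => [|j IH] w wj; rewrite num_wordS (num_wordS w).
  by rewrite /set_letter/= wj/= expr1; lra.
rewrite -[shift (_ w _ _)]/(set_letter (shift w) j true) IH// [in LHS]/set_letter/=.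
by rewrite (exprS _ j.+1) invfM; field.
Qed.

(** Raising letter [j] of [w] gains exactly [2 ^- j.+1] and stays letterwise below [z]. *)
Lemma num_word_gap0 (R : realType) (w z : iword R) j :
  (forall i, w i -> z i) -> w j = false -> z j ->
  num_word w + 2 ^- j.+1 <= num_word z.
Proof.
move=> le wj zj; rewrite -num_word_set_letter//; apply: num_word_le => i.
by rewrite /set_letter; case: eqP => [->|_]; [rewrite zj|exact: le].
Qed.

(** * Concatenations and membership in [Omega] *)

Lemma wcat_rconsE (R : realType) (w z : iword R) k b i :
  wcat (rcons (mkseq w k) b) z i =
  if (i < k)%N then w i else if i == k then b else z (i - k.+1)%N.
Proof.
rewrite /wcat nth_rcons size_rcons size_mkseq.
by case: ltnP => [ik|_]; [rewrite nth_mkseq|].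
Qed.

Lemma truncE (R : realType) (w : iword R) n i :
  trunc w n i = (i < n)%N && w i.
Proof.
rewrite /trunc /wcat; case: ltnP => ni; first by rewrite nth_mkseq.
by rewrite nth_default// size_mkseq.
Qed.

Lemma trunc_agree (R : realType) (w : iword R) n : agree n (trunc w n) w.
Proof. by move=> i ni; rewrite truncE ni. Qed.

Lemma wcat_nil {R : realType} (z : iword R) : wcat [::] z = z.
Proof. by apply/funext => i; rewrite /wcat subn0 nth_nil. Qed.

Lemma num_word_cons {R : realType} b v (z : iword R) :
  num_word (wcat (b :: v) z) = (b%:R + num_word (wcat v z)) / 2.
Proof. by rewrite num_wordS. Qed.

(** The prefix [v] acts on both values by the same affine map; without it both are 1/2. *)
Lemma num_word_adjacent {R : realType} (v : seq bool) :
  num_word (wcat (rcons v true) (zeros R)) =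
  num_word (wcat (rcons v false) (ones R)).
Proof.
elim: v => [|b v IH]; last by rewrite !rcons_cons !num_word_cons IH.
rewrite /= !num_word_cons.
by rewrite !wcat_nil num_word_zeros num_word_ones addr0 add0r.
Qed.

Lemma Omega_ex0 {R : realType} {w : iword R} i :
  Omega w -> exists2 j, (i <= j)%N & w j = false.
Proof.
move=> Ow; apply: contrapT => nex; apply: Ow; exists (mkseq w i).
apply/funext => j; rewrite /wcat; have [ji|ij] := ltnP j i.
  by rewrite nth_mkseq.
rewrite nth_default ?size_mkseq//; case wj : (w j) => //.
by exfalso; apply: nex; exists j.
Qed.

Lemma ex0_Omega {R : realType} {w : iword R} :
  (forall i, exists2 j, (i <= j)%N & w j = false) -> Omega w.
Proof.
move=> h [v wE]; have [j vj] := h (size v).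
by rewrite wE /wcat nth_default.
Qed.

Lemma Omega_wcat_zeros {R : realType} v : Omega (wcat v (zeros R)).
Proof.
apply: ex0_Omega => i; exists (maxn i (size v)); first exact: leq_maxl.
by rewrite /wcat nth_default// leq_maxr.
Qed.

Lemma num_word_lt1 (R : realType) (w : iword R) : Omega w -> num_word w < 1.
Proof.
move=> /(Omega_ex0 0)[j _ wj]; rewrite -(num_word_ones R).
rewrite (lt_le_trans _ (num_word_gap0 (z := ones R) _ wj _))//.
by rewrite ltrDl invr_gt0 exprn_gt0.
Qed.

(** * Order and bijectivity of [num_word] on [Omega] *)

Lemma le_adjacent_low (R : realType) (w : iword R) i : w i = false ->
  forall l, w l -> wcat (rcons (mkseq w i) false) (ones R) l.
Proof.
move=> wi l wl; rewrite wcat_rconsE wl; case: ltnP => // _.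
by case: eqP wl wi => [->->|].
Qed.

Lemma le_adjacent_high (R : realType) (w w' : iword R) i :
  agree i w w' -> w' i ->
  forall l, wcat (rcons (mkseq w i) true) (zeros R) l -> w' l.
Proof.
move=> ag wi l; rewrite wcat_rconsE; case: ltnP => [/ag ->|_]//.
by case: eqP => [->|].
Qed.

(** The common value of the two adjacent words with prefix [mkseq w i] separates the two sides.
    Strictness comes from a zero of [w] beyond [i], where the lower adjacent word has a one. *)
Lemma num_word_lt (R : realType) (w w' : iword R) i :
  Omega w -> agree i w w' -> w i = false -> w' i -> num_word w < num_word w'.
Proof.
move=> /(Omega_ex0 i.+1)[j ij wj] ag wi w'i.
rewrite (lt_le_trans _ (num_word_le (le_adjacent_high ag w'i)))//.
rewrite num_word_adjacent.
rewrite (lt_le_trans _ (num_word_gap0 (le_adjacent_low wi) wj _))//.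
  by rewrite ltrDl invr_gt0 exprn_gt0.
by rewrite wcat_rconsE ltnNge (ltnW ij)/= gtn_eqF.
Qed.

Lemma first_diff (R : realType) (w w' : iword R) :
  w <> w' -> exists2 i, agree i w w' & w i != w' i.
Proof.
move=> neq.
have ex : exists k, w k != w' k.
  apply: contrapT => nex; apply: neq; apply/funext => i.
  by apply/eqP/negPn/negP => h; apply: nex; exists i.
case: (ex_minnP ex) => k wk kmin; exists k => // i ik.
by apply/eqP/negPn/negP => /kmin; rewrite leqNgt ik.
Qed.

Lemma num_word_inj {R : realType} : {in @Omega R &, injective (@num_word R)}.
Proof.
move=> w w'; rewrite !inE => Ow Ow' e; apply: contrapT => /first_diff[i ag].
case wi : (w i); case w'i : (w' i) => // _.
- by have := num_word_lt Ow' (agreeC ag) w'i wi; rewrite e ltxx.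
- by have := num_word_lt Ow ag wi w'i; rewrite e ltxx.
Qed.

(* The i-th binary digit of x is read off the i-th iterate of x |-> 2x mod 1. *)
Definition doubling {R : realType} (x : R) : R :=
  if 2^-1 <= x then x * 2 - 1 else x * 2.

Definition digits {R : realType} (x : R) : iword R :=
  fun i => 2^-1 <= iter i doubling x.

Lemma doubling_itv {R : realType} (x : R) :
  0 <= x < 1 -> 0 <= doubling x < 1.
Proof.
by rewrite /doubling; case: (leP 2^-1 x) => ? /andP[? ?]; apply/andP; split; lra.
Qed.

Lemma shift_digits {R : realType} (x : R) : shift (digits x) = digits (doubling x).
Proof. by apply/funext => i; rewrite /shift /digits iterSr. Qed.

(** Passing from [x] to [doubling x] doubles the error, which never exceeds 1; hence it is at most
    [2 ^- k] for every [k]. *)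
Lemma num_word_digits {R : realType} (x : R) :
  0 <= x < 1 -> num_word (digits x) = x.
Proof.
move=> x01; apply/eqP; rewrite -subr_eq0 -normr_le0.
have close k (y : R) : 0 <= y < 1 -> `|num_word (digits y) - y| <= 2 ^- k.
  elim: k y => [|k IH] y y01.
    have := num_word_ge0 (digits y); have := num_word_le1 (digits y).
    case/andP: y01 => ? ?; rewrite expr0 invr1 ler_norml => *.
    by apply/andP; split; lra.
  have /IH := doubling_itv y01; rewrite (num_wordS (digits y)) shift_digits.
  rewrite exprSr invfM !ler_norml /digits/= /doubling.
  by case: (leP 2^-1 y) => _ /= /andP[? ?]; apply/andP; split; lra.
apply/ler_addgt0Pr => e e0; rewrite add0r.
have [k _ /(_ k (leqnn k))] := near_infty_natSinv_expn_lt (PosNum e0).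
by rewrite /= div1r => /ltW; exact/le_trans/close.
Qed.

(** Doubling strips [v] letter by letter and would end at a point of [0, 1) with all digits one,
    hence equal to 1. *)
Lemma Omega_digits {R : realType} (x : R) : 0 <= x < 1 -> Omega (digits x).
Proof.
move=> x01 [v]; elim: v x x01 => [|b v IH] x x01 e; last first.
  by apply: (IH _ (doubling_itv x01)); rewrite -shift_digits e.
have := num_word_digits x01; rewrite e wcat_nil num_word_ones => x1.
by move: x01; rewrite -x1 ltxx andbF.
Qed.

Lemma Omega_bin_word {R : realType} (x : R) : 0 <= x < 1 ->
  Omega (bin_word x) /\ num_word (bin_word x) = x.
Proof.
move=> x01; have im : ((@num_word R) @` @Omega R) x.
  by exists (digits x); [exact: Omega_digits|exact: num_word_digits].
split; last by rewrite /bin_word pinvK// inE.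
by apply: (@surjpinv_image_sub _ _ (fun=> zeros R) (@Omega R)
  ((@num_word R) @` @Omega R) (@num_word R)) => //; exists x.
Qed.

Lemma num_wordK (R : realType) (w : iword R) : Omega w -> bin_word (num_word w) = w.
Proof. by move=> Ow; apply: (pinvKV _ num_word_inj); rewrite inE. Qed.

Lemma hat_num_word {R : realType} (f : iword R -> option R) (w : iword R) :
  Omega w -> hat f (num_word w) = f w.
Proof. by move=> Ow; rewrite /hat num_word_ge0 num_word_lt1// num_wordK. Qed.

(** * Continuity in terms of common prefixes *)

Lemma expr_half_lt (R : realType) (e : R) : 0 < e -> exists k, 2 ^- k < e.
Proof.
move=> e0; have [k _ /(_ k (leqnn k))] := near_infty_natSinv_expn_lt (PosNum e0).
by rewrite /= div1r; exists k.
Qed.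

(** The ball is open: a distance strictly below [2 ^- k] forces one more common letter. *)
Lemma ball_agree (R : realType) (w w' : iword R) k :
  ball w (2 ^- k) w' <-> agree k.+1 w w'.
Proof. by rewrite ballEmdist; split=> [/dC_lt/eq_prefixP|/eq_prefixP/dC_lt]. Qed.

Lemma continuous_agreeP (R : realType) (g : iword R -> R) : continuous g <->
  forall w (e : R), 0 < e -> exists k, forall w', agree k w w' -> `|g w - g w'| < e.
Proof.
split=> [cg w e e0|h w].
  have /cvgrPdist_lt/(_ e e0)/nbhs_ballP[d d0 dP] := cg w.
  have [k kd] := expr_half_lt d0; exists k.+1 => w' /ball_agree ww'.
  by apply: dP; apply: le_ball ww'; exact: ltW.
apply/(@cvgrPdist_lt _ _ _ _ (@nbhs_filter (iword R) w)) => e e0; have [k kP] := h w e e0.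
apply/nbhs_ballP; exists (2 ^- k) => [|w' /ball_agree ww'] /=.
  by rewrite invr_gt0 exprn_gt0.
by apply: kP; exact: agreeW ww'.
Qed.

Definition agree_modulus (R : realType) (F : iword R -> R) (e : R) (k : nat) :=
  forall w w', Omega w -> Omega w' -> agree k w w' -> `|F w - F w'| < e.

Lemma unif_continuous_OmegaP (R : realType) (f : iword R -> option R) :
  unif_continuous_on (@Omega R) f <->
  (forall w, Omega w -> f w <> None) /\
  forall e, 0 < e -> exists k, agree_modulus (odflt 0 \o f) e k.
Proof.
split=> -[def uc]; split=> // e /uc.
  move=> [d d0 dP]; have [k kd] := expr_half_lt d0.
  exists k.+1 => w w' Ow Ow' /ball_agree ww' /=.
  have := dP _ _ Ow Ow' (le_ball (ltW kd) ww').
  by case: (f w) (def w Ow) (f w') (def w' Ow') => // a _ [b|//] _; exact.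
move=> [k kP]; exists (2 ^- k); first by rewrite invr_gt0 exprn_gt0.
move=> w w' Ow Ow' /ball_agree ww' a b fa fb.
by have := kP _ _ Ow Ow' (agreeW (leqnSn k) ww'); rewrite /= fa fb.
Qed.

(** Substituting [x = num_word w] moves the condition to [Omega], where it can be compared with
    prefix agreement. *)
Lemma unif_continuous_hatP (R : realType) (f : iword R -> option R) :
  unif_continuous_on (`[0, 1[ : set R) (hat f) <->
  (forall w, Omega w -> f w <> None) /\
  forall e : R, 0 < e -> exists2 d : R, 0 < d & forall w w', Omega w -> Omega w' ->
    `|num_word w - num_word w'| < d -> `|odflt 0 (f w) - odflt 0 (f w')| < e.
Proof.
have num01 (w : iword R) : Omega w -> `[0, 1[%classic (num_word w).
  by move=> Ow; rewrite /= in_itv/= num_word_ge0 num_word_lt1.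
split=> -[def uc]; split.
- by move=> w Ow; rewrite -hat_num_word//; apply: def; exact: num01.
- move=> e /uc[d d0 dP]; exists d => // w w' Ow Ow' ww'.
  have := dP _ _ (num01 _ Ow) (num01 _ Ow') ww'; rewrite !hat_num_word//.
  have := def _ (num01 _ Ow); have := def _ (num01 _ Ow').
  by rewrite !hat_num_word//; case: (f w) (f w') => [a|//] [b|//] _ _; exact.
- move=> x; rewrite /= in_itv/= => /Omega_bin_word[Ow xE].
  by rewrite -xE hat_num_word//; exact: def.
- move=> e /uc[d d0 dP]; exists d => // x y.
  rewrite /= !in_itv/= => /Omega_bin_word[Ox xE] /Omega_bin_word[Oy yE].
  rewrite -xE -yE !hat_num_word// => /(dP _ _ Ox Oy) + a b fa fb.
  by rewrite fa fb.
Qed.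

(** * Continuous extension from [Omega] *)

Lemma Omega_trunc (R : realType) (w : iword R) n : Omega (trunc w n).
Proof. exact: Omega_wcat_zeros. Qed.

(** Truncating both words at the same length keeps their agreement and lands in [Omega]; strictness
    is lost in the limit. *)
Lemma agree_modulus_extension (R : realType) (F g : iword R -> R) e k :
  continuous g -> (forall w, Omega w -> F w = g w) -> agree_modulus F e k ->
  forall w w', agree k w w' -> `|g w - g w'| <= e.
Proof.
move=> /continuous_agreeP cg Fg Fe w w' ww'; apply/ler_addgt0Pr => d d0.
have d20 : 0 < d / 2 by rewrite divr_gt0.
have [n nP] := cg w _ d20; have [n' n'P] := cg w' _ d20.
pose m := maxn k (maxn n n').
have tP (z : iword R) l : (l <= m)%N -> agree l z (trunc z m).
  by move=> lm; apply/agreeC/(agreeW lm); exact: trunc_agree.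
have := nP _ (tP _ _ _); rewrite !leq_max leqnn orbT => /(_ isT).
have := n'P _ (tP _ _ _); rewrite !leq_max leqnn !orbT => /(_ isT).
have : `|F (trunc w m) - F (trunc w' m)| < e.
  apply: Fe; try exact: Omega_trunc.
  by move=> i ik; rewrite !truncE ww'.
rewrite !Fg; try exact: Omega_trunc.
rewrite !ltr_norml ler_norml => /andP[? ?] /andP[? ?] /andP[? ?].
by apply/andP; split; lra.
Qed.

Lemma continuous_eq_Omega (R : realType) (g h : iword R -> R) :
  continuous g -> continuous h -> (forall w, Omega w -> g w = h w) -> g = h.
Proof.
move=> /continuous_agreeP cg /continuous_agreeP ch gh; apply/funext => w.
apply/eqP; rewrite -subr_eq0 -normr_le0; apply/ler_addgt0Pr => d d0; rewrite add0r.
have d20 : 0 < d / 2 by rewrite divr_gt0.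
have [n nP] := cg w _ d20; have [n' n'P] := ch w _ d20.
have tP l : (l <= maxn n n')%N -> agree l w (trunc w (maxn n n')).
  by move=> lm; apply/agreeC/(agreeW lm); exact: trunc_agree.
have := nP _ (tP _ (leq_maxl _ _)); have := n'P _ (tP _ (leq_maxr _ _)).
rewrite (gh _ (@Omega_trunc _ w _)).
by rewrite !ltr_norml ler_norml => /andP[? ?] /andP[? ?]; apply/andP; split; lra.
Qed.

(* The extension maps w to the limit of F along the truncations w_1...w_n 0^omega. *)
Lemma exists_extension (R : realType) (F : iword R -> R) :
  (forall e, 0 < e -> exists k, agree_modulus F e k) ->
  exists2 g, continuous g & forall w, Omega w -> F w = g w.
Proof.
move=> uc; pose u (w : iword R) n := F (trunc w n).
(* With [w = w'] this is the Cauchy property; with distinct words it yields continuity of the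
   limit. *)
have uP (e : R) : 0 < e -> exists k, forall w w', agree k w w' ->
    forall n m, (k <= n)%N -> (k <= m)%N -> `|u w n - u w' m| < e.
  move=> /uc[k kP]; exists k => w w' ww' n m kn km.
  apply: kP; try exact: Omega_trunc.
  by move=> i ik; rewrite !truncE ww'// !(leq_trans ik).
have ucvg w : cvgn (u w).
  apply/cauchy_cvgP/cauchy_exP => e /uP[k kP]; exists (u w k).
  by exists k => // n kn; rewrite -ball_normE /=; exact: kP.
have limP (e : R) : 0 < e -> exists k, forall w w', agree k w w' ->
    forall n, (k <= n)%N -> `|u w n - limn (u w')| <= e.
  move=> /uP[k kP]; exists k => w w' ww' n kn.
  apply/ler_addgt0Pr => d d0.
  have /cvgrPdist_lt/(_ d d0)[m _ /(_ _ (leq_maxl m k))] := ucvg w'.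
  have := kP _ _ ww' n (maxn m k) kn (leq_maxr _ _).
  rewrite !ltr_norml ler_norml => /andP[? ?] /= /andP[? ?].
  by apply/andP; split; lra.
exists (fun w => limn (u w)).
  apply/continuous_agreeP => w e e0; have e30 : 0 < e / 3 by rewrite divr_gt0.
  have [k kP] := limP _ e30; exists k => w' ww'.
  have := kP _ _ ww' k (leqnn k); have := kP w w (fun _ _ => erefl) k (leqnn k).
  by rewrite !ler_norml ltr_norml => /andP[? ?] /andP[? ?]; apply/andP; split; lra.
move=> w Ow; apply/esym/cvg_lim => //; apply/cvgrPdist_lt => e /uc[k kP].
exists k => // n kn; apply: kP => //; first exact: Omega_trunc.
by apply/agreeC/(agreeW kn); exact: trunc_agree.
Qed.

Theorem corollary57 (R : realType) (f : iword R -> option R) :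
  unif_continuous_on (`[0, 1[ : set R) (hat f) <->
  unif_continuous_on (@Omega R) f /\
  exists g : iword R -> R,
    unique (continuous_extension f) g /\
    forall v : seq bool,
      g (wcat (rcons v true) (zeros R)) = g (wcat (rcons v false) (ones R)).
Proof.
split.
  move=> /unif_continuous_hatP[def uc].
  have mod e : 0 < e -> exists k, agree_modulus (odflt 0 \o f) e k.
    move=> /uc[d d0 dP]; have [k kd] := expr_half_lt d0; exists k => w w' Ow Ow' ww'.
    by apply: dP => //; apply: le_lt_trans kd; exact: num_word_agree.
  split; first exact/unif_continuous_OmegaP.
  have [g cg gP] := exists_extension mod.
  have fg w : Omega w -> f w = Some (g w).
    by move=> Ow; rewrite -gP//=; case: (f w) (def w Ow).
  exists g; split.
    split=> // h [ch fh]; apply: continuous_eq_Omega => // w Ow.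
    by apply: Some_inj; rewrite -fg// fh.
  move=> v; set hi := wcat _ (zeros R); set lo := wcat _ (ones R).
  apply/eqP; rewrite -subr_eq0 -normr_le0; apply/ler_addgt0Pr => e e0; rewrite add0r.
  have e20 : 0 < e / 2 by rewrite divr_gt0.
  have [d d0 dP] := uc _ e20; have [k kd] := expr_half_lt d0.
  have /continuous_agreeP/(_ lo _ e20)[l lP] := cg.
  (* [lo] is outside [Omega], so a truncation replaces it: long enough to be within [d] of [hi] in
     value, and within [e / 2] of [lo] under [g]. *)
  pose m := maxn k l; have Ohi : Omega hi by exact: Omega_wcat_zeros.
  have tP j : (j <= m)%N -> agree j lo (trunc lo m).
    by move=> jm; apply/agreeC/(agreeW jm); exact: trunc_agree.
  have := lP _ (tP _ (leq_maxr _ _)).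
  have : `|odflt 0 (f hi) - odflt 0 (f (trunc lo m))| < e / 2.
    apply: dP => //; first exact: Omega_trunc.
    rewrite num_word_adjacent; apply: le_lt_trans kd; apply: num_word_agree.
    exact/tP/leq_maxl.
  rewrite !fg//=; last exact: Omega_trunc.
  by rewrite !ltr_norml ler_norml => /andP[? ?] /andP[? ?]; apply/andP; split; lra.
move=> [/unif_continuous_OmegaP[def mod] [g [[[cg fg] _] gadj]]].
apply/unif_continuous_hatP; split=> // e e0.
(* At most two jumps are made, each with a non-strict bound; thirds keep the sum strictly below
   [e]. *)
have e30 : 0 < e / 3 by rewrite divr_gt0.
have [k kP] := mod _ e30; exists (2 ^- k); first by rewrite invr_gt0 exprn_gt0.
have gk : forall w w', agree k w w' -> `|g w - g w'| <= e / 3.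
  by apply: agree_modulus_extension kP => // w Ow; rewrite /= fg.
move=> w w' Ow Ow'; rewrite !fg//=.
have [ag _|nag] := pselect (agree k w w').
  by rewrite (le_lt_trans (gk _ _ ag))// ltr_pdivrMr//; lra.
have /first_diff[i ag wi] : w <> w' by move=> ww'; apply: nag; rewrite ww'.
clear nag; wlog : w w' Ow Ow' ag wi / w i = false.
  move=> wl; case wiE : (w i); last exact: wl.
  rewrite distrC [in X in _ -> X]distrC; apply: wl => //.
  - exact: agreeC.
  - by rewrite eq_sym.
  - by move: wi; rewrite wiE; case: (w' i).
move=> wi0; have w'i : w' i by move: wi; rewrite wi0; case: (w' i).
set lo := wcat (rcons (mkseq w i) false) (ones R).
set hi := wcat (rcons (mkseq w i) true) (zeros R).
rewrite distrC => near.
(* The value shared by [lo] and [hi] lies between those of [w] and [w'], so it is within [2 ^- k] of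
   both. *)
have wlo := le_adjacent_low wi0; have hiw := le_adjacent_high ag w'i.
have hilo : num_word hi = num_word lo by exact: num_word_adjacent.
have tail j : (j < k)%N -> 2 ^- k <= 2 ^- j.+1 :> R.
  by move=> jk; rewrite lef_pV2 ?posrE ?exprn_gt0// ler_weXn2l// ler1n.
(* A letter of w disagreeing with lo at j < k would push num_word w down by at
   least 2^-k; symmetrically for w' and hi below. *)
have aglo : agree k w lo.
  move=> j jk; case wj : (w j); first by rewrite /lo wlo.
  case loj : (lo j) => //; exfalso.
  have := num_word_gap0 wlo wj loj; have := num_word_le hiw.
  move: near (tail _ jk); rewrite -/hi -/lo hilo ltr_norml => /andP[? ?]; lra.
have aghi : agree k hi w'.
  move=> j jk; case w'j : (w' j); last first.
    by apply/negbTE/negP => /hiw; rewrite w'j.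
  case hij : (hi j) => //; exfalso.
  have := num_word_gap0 hiw hij w'j; have := num_word_le wlo.
  move: near (tail _ jk); rewrite -/hi -/lo hilo ltr_norml => /andP[? ?]; lra.
(* Condition (2) identifies [g lo] with [g hi] and so joins the two estimates. *)
have := gk _ _ aglo; have := gk _ _ aghi; rewrite -[g lo]gadj -/hi.
by rewrite !ler_norml ltr_norml => /andP[? ?] /andP[? ?]; apply/andP; split; lra.
Qed.
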